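(* Let $B,\bar B$ be real or complex vector spaces and let $L(\varepsilon)=\sum_{i=0}^\infty\varepsilon^iL_i$, $L_i\in L(B,\bar B)$, be a formal power series of linear maps. Let the recursion described in the context be performed up to $k\ge0$, with associated direct sums $$B=N_1^c\oplus\cdots\oplus N_{k+1}^c\oplus N_{k+1},\qquad \bar B=R_1\oplus\cdots\oplus R_{k+1}\oplus R_{k+1}^c.$$ Then the polynomial in $\varepsilon$ of degree $k$ $$p_k(\varepsilon)=I_B+\varepsilon M_{k,k+1}+\cdots+\varepsilon^kM_{1,k+1}=(\varepsilon^k\ \cdots\ \varepsilon\ 1)\cdot M_{k+1}$$ transforms $L(\varepsilon)$ into $$S_k(\varepsilon)=L(\varepsilon)\cdot p_k(\varepsilon)=S_1+\varepsilon S_2+\cdots+\varepsilon^kS_{k+1}+\sum_{i=k+1}^\infty\varepsilon^iQ_{i+1}$$ (with some $Q_{i+1}\in L(B,\bar B)$), where the $k+1$ leading coefficients $S_1,\dots,S_{k+1}\in L(B,\bar B)$ satisfy $$S_i(N_0^c+\cdots+N_{i-1}^c)\subset R_{i-1}^c,\qquad S_iN_i^c=R_i,\qquad S_iN_i=0,\qquad i=1,\dots,k+1.$$ That is, in the block matrix representation of $S_i$ with respect to the direct sums $B=N_1^c\oplus\cdots\oplus N_{k+1}^c\oplus N_{k+1}$ and $\bar B=R_1\oplus\cdots\oplus R_{k+1}\oplus R_{k+1}^c$, the columns $N_1^c,\dots,N_{i-1}^c$ have possibly nonzero entries only in the rows $R_i,\dots,R_{k+1},R_{k+1}^c$, the column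 $N_i^c$ has a nonzero entry at most in the row $R_i$, and the columns $N_{i+1}^c,\dots,N_{k+1}^c,N_{k+1}$ vanish. Consequently the operator polynomial $P_k(\varepsilon):=S_1+\varepsilon S_2+\cdots+\varepsilon^kS_{k+1}$ is lower triangular: its block matrix (columns $N_1^c,\dots,N_{k+1}^c,N_{k+1}$; rows $R_1,\dots,R_{k+1},R_{k+1}^c$) has diagonal blocks $S_1,\varepsilon S_2,\dots,\varepsilon^kS_{k+1}$ in the positions $(R_i,N_i^c)$, zero blocks above these diagonal blocks, zero column $N_{k+1}$, and zero block in position $(R_{k+1}^c,N_{k+1}^c)$.
   Context: Notation. $L(B,\bar B)$ denotes linear maps (not necessarily bounded), $N[T]$ and $R[T]$ the kernel and range of $T$, $I_B$ the identity of $B$. Products of formal power series are Cauchy products. Recursion. Set $N_0:=B$, $N_0^c:=\{0\}$, $R_0:=\{0\}$, $R_0^c:=\bar B$, $\bar S_1:=S_1:=L_0$, $N_1:=N[S_1]$, $R_1:=R[S_1]$; let $N_1^c$ be a chosen (algebraic) complement of $N_1$ in $N_0$ and $R_1^c$ a chosen complement of $R_1$ in $R_0^c$. Set $M_1:=M^{(1)}:=I_B$. For $k\ge1$, given the upper triangular operator matrix $M^{(k)}$ ($k\times k$, entries in $L(B,B)$) with last column $M_k$, define $$\bar S_{k+1}:=(L_1\ \cdots\ L_k)\cdot M_k,\qquad S_{k+1}:=P_{R_k^c}\bar S_{k+1},$$ where $P_{R_k^c}$ is the projection of $\bar B=R_1\oplus\cdots\oplus R_k\oplus R_k^c$ onto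 $R_k^c$ along $R_1\oplus\cdots\oplus R_k$. Put $N_{k+1}:=N[S_{k+1}|_{N_k}]$, $R_{k+1}:=R[S_{k+1}|_{N_k}]$; let $N_{k+1}^c$ be a chosen complement of $N_{k+1}$ in $N_k$ and $R_{k+1}^c$ a chosen complement of $R_{k+1}$ in $R_k^c$. This gives $B=N_1^c\oplus\cdots\oplus N_{k+1}^c\oplus N_{k+1}$ and $\bar B=R_1\oplus\cdots\oplus R_{k+1}\oplus R_{k+1}^c$. Let $\mathcal P_i$ be the projection onto $R_i$ with respect to the latter direct sum. $S_i$ restricts to a bijection $N_i^c\to R_i$, and $S_i^{-1}:R_i\to N_i^c$ denotes its inverse. Define an operator column $E_{k+1}=(E_{1,k+1},\dots,E_{k+1,k+1})^T$ from bottom to top by $$E_{k+1,k+1}:=I_B,\qquad E_{i,k+1}:=-S_i^{-1}\mathcal P_i\sum_{\nu=i+1}^{k+1}\bar S_\nu E_{\nu,k+1},\quad i=k,\dots,1,$$ then the column $$M_{k+1}=(M_{1,k+1},\dots,M_{k+1,k+1})^T:=\begin{pmatrix}I_B&0\\ 0&M^{(k)}\end{pmatrix}E_{k+1},$$ and let $M^{(k+1)}$ be the $(k+1)\times(k+1)$ upper triangular matrix whose columns are $M_1,\dots,M_{k+1}$ (filled up with zeros below). One has $M_{i,i}=I_B$. ''Polynomial of degree $k$'' means of degree at most $k$ in $\varepsilon$. *)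

(* Defs.v *)
(* MathComp, with classical sets.

   - The scalar field is an arbitrary K : numFieldType, which covers both the
     real and the complex numbers; vector spaces are K-modules of arbitrary
     dimension, subspaces are sets closed under linear combinations.
   - A formal power series with operator coefficients is the sequence of its
     coefficients.
   - The operators produced by the recursion are plain functions: their
     linearity is something to be proved, not part of the data.
   - All indices are those of the mathematical text: N_0, N_0^c, R_0, R_0^c
     start at 0, whereas S_i, M_{i,j}, E_{i,j} and the summands of the direct
     sums start at 1. *)
From HB Require Import structures.
From mathcomp Require Import all_boot all_order all_algebra.
From mathcomp Require Import boolp classical_sets functions.

Set Implicit Arguments.
Unset Strict Implicit.
Unset Printing Implicit Defensive.

Import Order.TTheory GRing.Theory Num.Theory.
Local Open Scope classical_set_scope.
Local Open Scope ring_scope.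

Section Subspaces.
Variables (K : numFieldType) (V : lmodType K).
Implicit Types (A C W : set V) (X : nat -> set V).

Definition is_subspace A : Prop := submod_closed (mem A).

Definition is_complement A C W : Prop :=
  [/\ is_subspace C, A `&` C = [set 0] & [set u + v | u in A & v in C] = W].

Definition selection X (a b : nat) (x : nat -> V) : Prop :=
  forall j, (a <= j < b)%N -> X j (x j).

(* X_a + ... + X_(b-1) *)
Definition sum_of X (a b : nat) : set V :=
  [set \sum_(a <= j < b) x j | x in selection X a b].

(* W = X_a (+) ... (+) X_(b-1) *)
Definition direct_sum X (a b : nat) W : Prop :=
  [/\ forall j, (a <= j < b)%N -> is_subspace (X j),
      sum_of X a b = W
    & forall x y, selection X a b x -> selection X a b y ->
        \sum_(a <= j < b) x j = \sum_(a <= j < b) y j ->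
        forall j, (a <= j < b)%N -> x j = y j].

(* The projection onto X_i along the other summands X_j, a <= j < b, j != i:
   v is sent to the i-th term of its decomposition.  (The value is unspecified
   when v has several decompositions, and 0 when v has none.) *)
Definition proj X (a b i : nat) (v : V) : V :=
  xget 0 [set u | exists x, [/\ selection X a b x,
                                \sum_(a <= j < b) x j = v & x i = u]].

(* The n+1 summands X_1, ..., X_n, Y_n, numbered from 1 to n+1. *)
Definition blocks X (Y : nat -> set V) (n i : nat) : set V :=
  if (i <= n)%N then X i else Y n.

End Subspaces.

Section Series.
Variables (K : numFieldType) (U V W : lmodType K).

Definition cauchy_product (F : nat -> V -> W) (G : nat -> U -> V) :
    nat -> U -> W :=
  fun n => \sum_(i < n.+1) (F i \o G (n - i)%N).

(* c_0 + eps c_1 + ... + eps^k c_k *)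
Definition op_poly (k : nat) (c : nat -> U -> V) : nat -> U -> V :=
  fun n => if (n <= k)%N then c n else 0.

(* eps^m T *)
Definition op_monomial (m : nat) (T : U -> V) : nat -> U -> V :=
  fun n => if n == m then T else 0.

End Series.

Section BlockMatrix.
Variables (K : numFieldType) (B Bbar : lmodType K).

(* The operator T restricted to the set A, extended by 0 outside A. *)
Definition restr (A : set B) (T : B -> Bbar) : B -> Bbar := patch (cst 0) A T.

(* The entry in row r and column c of the block matrix of T with respect to the
   summands X_1, ..., X_m of B and Y_1, ..., Y_m of Bbar. *)
Definition block (X : nat -> set B) (Y : nat -> set Bbar) (m r c : nat)
    (T : B -> Bbar) : B -> Bbar :=
  restr (X c) (proj Y 1 m.+1 r \o T).

Definition block_series (X : nat -> set B) (Y : nat -> set Bbar) (m r c : nat)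
    (F : nat -> B -> Bbar) : nat -> B -> Bbar :=
  fun n => block X Y m r c (F n).

End BlockMatrix.

(* The recursion performed up to k: Nc and Rc are the chosen complements, and
   all other data are determined by them for the indices occurring below. *)
Record recursion (K : numFieldType) (B Bbar : lmodType K)
    (L : nat -> {linear B -> Bbar}) (k : nat)
    (Nc N : nat -> set B) (Rc R : nat -> set Bbar)
    (Sbar S : nat -> B -> Bbar) (E M : nat -> nat -> B -> B) : Prop :=
  Recursion {
    rec_N0 : N 0%N = setT;
    rec_Nc0 : Nc 0%N = [set 0];
    rec_R0 : R 0%N = [set 0];
    rec_Rc0 : Rc 0%N = setT;
    rec_Sbar1 : Sbar 1%N = L 0%N;
    rec_S1 : S 1%N = Sbar 1%N;
    rec_M11 : M 1%N 1%N = id;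
    rec_SbarS : forall j, (1 <= j <= k)%N ->
      Sbar j.+1 = \sum_(1 <= i < j.+1) (L i \o M i j);
    rec_SS : forall j, (1 <= j <= k)%N ->
      S j.+1 = proj (blocks R Rc j) 1 j.+2 j.+1 \o Sbar j.+1;
    rec_N : forall j, (j <= k)%N -> N j.+1 = N j `&` [set x | S j.+1 x = 0];
    rec_R : forall j, (j <= k)%N -> R j.+1 = S j.+1 @` N j;
    rec_Nc : forall j, (j <= k)%N -> is_complement (N j.+1) (Nc j.+1) (N j);
    rec_Rc : forall j, (j <= k)%N -> is_complement (R j.+1) (Rc j.+1) (Rc j);
    rec_Ediag : forall j, (1 <= j <= k)%N -> E j.+1 j.+1 = id;
    rec_E : forall j, (1 <= j <= k)%N -> forall i, (1 <= i <= j)%N ->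
      E i j.+1 =
        - ('pinv_(cst 0) (Nc i) (S i)
             \o proj (blocks R Rc j.+1) 1 j.+3 i
             \o \sum_(i.+1 <= nu < j.+2) (Sbar nu \o E nu j.+1));
    (* M_(j+1) = diag (I, M^(j)) E_(j+1) *)
    rec_M1 : forall j, (1 <= j <= k)%N -> M 1%N j.+1 = E 1%N j.+1;
    rec_MS : forall j, (1 <= j <= k)%N -> forall i, (1 <= i <= j)%N ->
      M i.+1 j.+1 = \sum_(1 <= nu < j.+1) (M i nu \o E nu.+1 j.+1);
    rec_Mlow : forall i j, (1 <= j <= k.+1)%N -> (j < i <= k.+1)%N ->
      M i j = 0
  }.

(* Main.v *)
Require Import Defs.
From HB Require Import structures.
From mathcomp Require Import all_boot all_order all_algebra.
From mathcomp Require Import boolp classical_sets functions.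
From mathcomp Require Import zify.

Set Implicit Arguments.
Unset Strict Implicit.
Unset Printing Implicit Defensive.

Import Order.TTheory GRing.Theory Num.Theory.
Local Open Scope classical_set_scope.
Local Open Scope ring_scope.

(** Write c(j, n) for the coefficient of eps^n in L(eps) p_j(eps), so that
    c(j, n) is the sum of the L_i M_(j+1-n+i, j+1) for 0 <= i <= n.  The heart
    of the matter is [coef_column]: c(j, n) = S_(n+1) for all n <= j <= k.
    Since M_(j+1) = diag (I, M^(j)) E_(j+1), every coefficient of the series
    at stage j is a combination, with weights taken from E_(j+1), of
    coefficients at earlier stages (plus L_0 E_(1,j+1) when n = j).

    For n = j this gives the sum of Sbar_nu E_(nu,j+1) over 1 <= nu <= j+1,
    and back substitution has been set up to make that sum equal to S_(j+1)
    ([sum_Sbar_E]).  To see it, compare the components in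
    R_1, ..., R_(j+1), Rc_(j+1).  Modulo R_1 + ... + R_(nu-1) the operators
    Sbar_nu and S_nu agree ([proj_Sbar]), and E_(nu,j+1) takes its values in
    Nc_nu, which S_nu maps into R_nu.  Hence for i <= j the terms nu < i do not
    contribute to the component in R_i, the term nu = i contributes
    S_i E_(i,j+1), and E_(i,j+1) is chosen to cancel the contribution of the
    terms nu > i; on the remaining components only the last term, where
    E_(j+1,j+1) = I, is seen.

    For n < j the same expansion yields the sum over nu <= j of
    c(nu-1, n-(j-nu)) E_(nu+1,j+1), which by induction is the sum of the
    S_(n+1-(j-nu)) E_(nu+1,j+1).  The term nu = j is S_(n+1); the others vanish
    because E_(nu+1,j+1) takes its values in Nc_(nu+1), which lies in N_nu and
    is therefore annihilated by S_1, ..., S_nu.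

    The mapping properties and the shape of the block matrices only use that
    S_i maps everything into Rc_(i-1), maps N_(i-1) onto R_i, and kills N_i.
    All of this presupposes that the projections are linear, hence that the
    operators produced so far are; [recursion_linear] establishes this along
    the recursion, jointly with the fact that the N_i and R_i are subspaces,
    on which the direct sums depend. *)

(** * Linear functions *)

Section LinearFunctions.
Variables (K : numFieldType).
Implicit Types U V W : lmodType K.

(** The operators of the recursion are bare functions; this gives access to the
    theory of bundled linear maps once linearity has been proved. *)
Definition linear_map U V (f : U -> V) (Hf : linear f) : {linear U -> V} :=
  HB.pack f (GRing.isLinear.Build K U V *:%R f Hf).

Lemma lin0 U V (f : U -> V) : linear f -> f 0 = 0.
Proof. by move=> Hf; exact: linear0 (linear_map Hf). Qed.

Lemma linB U V (f : U -> V) u v : linear f -> f (u - v) = f u - f v.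
Proof. by move=> Hf; exact: linearB (linear_map Hf) u v. Qed.

Lemma linN U V (f : U -> V) u : linear f -> f (- u) = - f u.
Proof. by move=> Hf; exact: linearN (linear_map Hf) u. Qed.

Lemma linD U V (f : U -> V) u v : linear f -> f (u + v) = f u + f v.
Proof. by move=> Hf; exact: linearD (linear_map Hf) u v. Qed.

Lemma lin_sum U V (f : U -> V) (I : Type) (r : seq I) (P : pred I) F :
  linear f -> f (\sum_(i <- r | P i) F i) = \sum_(i <- r | P i) f (F i).
Proof. by move=> Hf; exact: (linear_sum (linear_map Hf)). Qed.

Lemma linear_zero U V : linear (0 : U -> V).
Proof. by move=> a u v; rewrite /= scaler0 addr0. Qed.

Lemma linear_o U V W (f : V -> W) (g : U -> V) :
  linear f -> linear g -> linear (f \o g).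
Proof. by move=> Hf Hg a u v; rewrite /= Hg Hf. Qed.

Lemma linear_opp U V (f : U -> V) : linear f -> linear (- f).
Proof.
by move=> Hf a u v; rewrite opprfctE Hf opprD scalerN.
Qed.

Lemma linear_bigsum U V (I : eqType) (r : seq I) (P : pred I)
    (F : I -> U -> V) :
  (forall i, i \in r -> P i -> linear (F i)) ->
  linear (\sum_(i <- r | P i) F i).
Proof.
move=> HF a u v; rewrite fct_sumE scaler_sumr -big_split /=.
rewrite big_seq_cond [RHS]big_seq_cond.
by apply: eq_bigr => i /andP[ir Pi]; rewrite HF.
Qed.

End LinearFunctions.

(** * Subspaces and direct sums *)

Section DirectSums.
Variables (K : numFieldType) (V : lmodType K).
Implicit Types (A C W : set V) (X Y : nat -> set V).

Lemma subspaceE A : is_subspace A <->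
  A 0 /\ forall (a : K) u v, A u -> A v -> A (a *: u + v).
Proof.
split=> [[/set_mem A0 AL]|[A0 AL]]; split=> //.
- by move=> a u v Au Av; apply: set_mem; apply: AL; apply: mem_set.
- exact: mem_set.
- by move=> a u v /set_mem Au /set_mem Av; apply/mem_set/AL.
Qed.

Lemma subspace0 A : is_subspace A -> A 0.
Proof. by move=> /subspaceE[]. Qed.

Lemma subspaceD A u v : is_subspace A -> A u -> A v -> A (u + v).
Proof. by move=> /subspaceE[_ AL] Au Av; rewrite -[u]scale1r; apply: AL. Qed.

Lemma subspaceB A u v : is_subspace A -> A u -> A v -> A (u - v).
Proof.
by move=> /subspaceE[_ AL] Au Av; rewrite addrC -scaleN1r; apply: AL.
Qed.

Lemma subspaceT : is_subspace [set: V].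
Proof. by apply/subspaceE. Qed.

Section Projections.
Variables (X : nat -> set V) (a b : nat) (W : set V).
Hypothesis HX : direct_sum X a b W.

Lemma projE x i : selection X a b x -> (a <= i < b)%N ->
  proj X a b i (\sum_(a <= j < b) x j) = x i.
Proof.
move=> Hx Hi; case: HX => _ _ HU; rewrite /proj.
case: xgetP => [u _ [y [Hy Hs <-]]|/(_ (x i)) []].
  exact: HU Hy Hx Hs i Hi.
by exists x.
Qed.

Lemma proj_decomp v : W v ->
  selection X a b (fun j => proj X a b j v) /\
  \sum_(a <= j < b) proj X a b j v = v.
Proof.
case: (HX) => _ <- _ [x Hx <-].
have Hp j : (a <= j < b)%N -> proj X a b j (\sum_(a <= j < b) x j) = x j.
  exact: projE.
split=> [j Hj|]; first by rewrite Hp //; exact: Hx.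
by apply: eq_big_nat => j Hj; rewrite Hp.
Qed.

Lemma proj_in i v : W v -> (a <= i < b)%N -> X i (proj X a b i v).
Proof. by move=> /proj_decomp[H _]; exact: H. Qed.

Lemma proj_inj u v : W u -> W v ->
  (forall i, (a <= i < b)%N -> proj X a b i u = proj X a b i v) -> u = v.
Proof.
move=> /proj_decomp[_ Eu] /proj_decomp[_ Ev] H.
by rewrite -[LHS]Eu -[RHS]Ev; exact: eq_big_nat.
Qed.

Lemma proj_summand i j v : X i v -> (a <= i < b)%N -> (a <= j < b)%N ->
  proj X a b j v = if j == i then v else 0.
Proof.
move=> Xv Hi Hj; case: (HX) => HS _ _.
pose x l := if l == i then v else 0.
have Hx : selection X a b x.
  move=> l Hl; rewrite /x; case: eqP => [->//|_].
  by apply: subspace0; exact: HS.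
rewrite -[RHS]/(x j) -(projE Hx Hj); congr (proj X a b j _).
rewrite (bigD1_seq i) ?mem_index_iota ?iota_uniq //= /x eqxx.
by rewrite big1 ?addr0 // => l /negPf ->.
Qed.

End Projections.

Lemma proj_linear X a b i : direct_sum X a b setT -> (a <= i < b)%N ->
  linear (proj X a b i).
Proof.
move=> HX Hi c u v.
have [[Hu Eu] [Hv Ev]] : (selection X a b (fun j => proj X a b j u) /\
    \sum_(a <= j < b) proj X a b j u = u) /\
    (selection X a b (fun j => proj X a b j v) /\
    \sum_(a <= j < b) proj X a b j v = v).
  by split; apply: proj_decomp HX _ _.
rewrite -{1}Eu -{1}Ev scaler_sumr -big_split /= (projE HX) // => j Hj.
have [HS _ _] := HX; have /subspaceE[_ HL] := HS j Hj.
by apply: HL; [exact: Hu|exact: Hv].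
Qed.

(** The common pattern behind both chains of complements: it holds for
    (X, Y) = (Nc, N) in B and for (X, Y) = (R, Rc) in Bbar. *)
Definition splitting X Y n : Prop :=
  Y 0%N = setT /\ forall j, (j < n)%N ->
    [/\ is_subspace (X j.+1), is_subspace (Y j.+1),
        X j.+1 `&` Y j.+1 = [set 0] &
        [set u + v | u in X j.+1 & v in Y j.+1] = Y j].

Lemma splittingW X Y m n : (m <= n)%N -> splitting X Y n -> splitting X Y m.
Proof. by move=> mn [Y0 H]; split=> // j Hj; apply: H; lia. Qed.

Lemma blocks_low X Y n i : (i <= n)%N -> blocks X Y n i = X i.
Proof. by rewrite /blocks => ->. Qed.

Lemma blocks_last X Y n : blocks X Y n n.+1 = Y n.
Proof. by rewrite /blocks ltnn. Qed.

Lemma splitting_subspace X Y n j : splitting X Y n -> (j <= n)%N ->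
  is_subspace (Y j).
Proof.
case: j => [[-> _] _|j [_ H] Hj]; first exact: subspaceT.
by case: (H j Hj).
Qed.

Lemma splitting_sub X Y n i j : splitting X Y n -> (i <= j <= n)%N ->
  Y j `<=` Y i.
Proof.
move=> HXY; elim: j => [|j IH] Hij; first by have -> : i = 0%N by lia.
have [->//|ij] := eqVneq i j.+1.
apply: subset_trans (IH _); last by lia.
have [_ /(_ j)[|HX _ _ <- v Yv]] := HXY; first by lia.
by exists 0; [exact: subspace0|exists v; rewrite ?add0r].
Qed.

Lemma splitting_subX X Y n i j : splitting X Y n -> (i < j <= n)%N ->
  X j `<=` Y i.
Proof.
case: j => // j HXY Hij.
apply: (@subset_trans _ (Y j)); last by apply: splitting_sub HXY _; lia.
have [_ /(_ j)[|_ HY _ <- v Xv]] := HXY; first by lia.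
by exists v => //; exists 0; rewrite ?addr0 //; exact: subspace0.
Qed.

(** By induction on n, cutting the last summand Y_n into two pieces. *)
Lemma direct_sum_blocks X Y n : splitting X Y n ->
  direct_sum (blocks X Y n) 1 n.+2 setT.
Proof.
move=> HXY; split.
- move=> j Hj; rewrite /blocks; case: ifP => jn.
    by case: j Hj jn => // j _ jn; have [_ /(_ j jn)[]] := HXY.
  exact: splitting_subspace HXY (leqnn n).
- apply/seteqP; split=> // v _.
  elim: n HXY => [|n IH] HXY.
    exists (fun=> v); last by rewrite big_nat1.
    by move=> j Hj; rewrite /blocks ifF ?(proj1 HXY) //; lia.
  have [x Hx <-] := IH (splittingW (leqnSn n) HXY).
  have [_ /(_ n (leqnn _))[HX HY _ HS]] := HXY.
  have : Y n (x n.+1) by rewrite -(blocks_last X); apply: Hx; lia.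
  rewrite -HS => -[u Xu [w Yw xE]].
  exists (fun j => if (j <= n)%N then x j else if j == n.+1 then u else w).
    move=> j Hj; case: leqP => jn.
      by have := Hx j; rewrite !blocks_low //; [apply; lia|lia].
    case: eqVneq => [->|ne]; first by rewrite blocks_low.
    have -> : j = n.+2 by lia.
    by rewrite blocks_last.
  rewrite big_nat_recr //= big_nat_recr //= [RHS]big_nat_recr //=.
  rewrite ltnn eqxx (_ : (n.+2 <= n)%N = false); last by lia.
  rewrite (_ : (n.+2 == n.+1) = false); last by lia.
  rewrite -addrA xE; congr (_ + _).
  by apply: eq_big_nat => j Hj; rewrite ifT //; lia.
- elim: n HXY => [|n IH] HXY x y Hx Hy.
    rewrite !big_nat1 => E j Hj.
    by have -> : j = 1%N by lia.
  have [_ /(_ n (leqnn _))[HX HY HI HS]] := HXY.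
  (* Merging the last two terms brings back the decomposition one step
     earlier. *)
  pose merge (z : nat -> V) j := if j == n.+1 then z n.+1 + z n.+2 else z j.
  have merge_sel z : selection (blocks X Y n.+1) 1 n.+3 z ->
      selection (blocks X Y n) 1 n.+2 (merge z) /\
      \sum_(1 <= j < n.+3) z j = \sum_(1 <= j < n.+2) merge z j.
    move=> Hz; split.
      move=> j Hj; rewrite /merge; case: eqVneq => [->|ne].
        rewrite blocks_last -HS; exists (z n.+1).
          by have := Hz n.+1; rewrite blocks_low //; apply; lia.
        exists (z n.+2) => //; have := Hz n.+2.
        by rewrite blocks_last; apply; lia.
      by have := Hz j; rewrite !blocks_low //; [apply|..]; lia.
    rewrite big_nat_recr //= big_nat_recr //= [RHS]big_nat_recr //=.
    rewrite /merge eqxx -addrA; congr (_ + _).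
    by apply: eq_big_nat => j Hj; rewrite ifF //; lia.
  have [Hx' ->] := merge_sel x Hx; have [Hy' ->] := merge_sel y Hy => E.
  have H := IH (splittingW (leqnSn n) HXY) _ _ Hx' Hy' E.
  have E1 : x n.+1 + x n.+2 = y n.+1 + y n.+2.
    by have := H n.+1; rewrite /merge eqxx; apply; lia.
  have sel1 z : selection (blocks X Y n.+1) 1 n.+3 z -> X n.+1 (z n.+1).
    by move=> /(_ n.+1); rewrite blocks_low //; apply; lia.
  have sel2 z : selection (blocks X Y n.+1) 1 n.+3 z -> Y n.+1 (z n.+2).
    by move=> /(_ n.+2); rewrite blocks_last; apply; lia.
  have E2 : x n.+1 - y n.+1 = y n.+2 - x n.+2.
    by apply/eqP; rewrite subr_eq addrAC eq_sym subr_eq E1 addrC.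
  have : (X n.+1 `&` Y n.+1) (x n.+1 - y n.+1).
    by split; [|rewrite E2]; apply: subspaceB => //;
      do ?[exact: sel1|exact: sel2].
  rewrite HI /= => E0; move: (E0) E2 => /subr0_eq E3.
  rewrite E0 => /esym/subr0_eq E4 j Hj.
  have [->//|ne1] := eqVneq j n.+1; have [->//|ne2] := eqVneq j n.+2.
  have := H j; rewrite /merge (negPf ne1); apply; lia.
Qed.

Section SplittingProjections.
Variables (X Y : nat -> set V) (n : nat).
Hypothesis HXY : splitting X Y n.
Let P := proj (blocks X Y n) 1 n.+2.

Lemma proj_blocks_linear i : (1 <= i <= n.+1)%N -> linear (P i).
Proof. by move=> Hi; apply: proj_linear (direct_sum_blocks HXY) _; lia. Qed.

Lemma proj_blocks_summand i j v : X i v -> (1 <= i <= n)%N ->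
  (1 <= j <= n.+1)%N -> P j v = if j == i then v else 0.
Proof.
move=> Xv Hi Hj; apply: (proj_summand (direct_sum_blocks HXY)); try lia.
by rewrite blocks_low //; lia.
Qed.

(** Because Y_i = X_(i+1) (+) ... (+) X_n (+) Y_n.  This relates the
    decompositions of different levels without comparing their projections. *)
Lemma proj_blocks_tail i j v : Y i v -> (i <= n)%N -> (1 <= j <= i)%N ->
  P j v = 0.
Proof.
move=> Yv Hi; move: Yv; rewrite -(subKn Hi).
move: (leq_subr i n); move: (n - i)%N => d; elim: d v => [|d IH] v Hd.
  rewrite subn0 => Yv Hj.
  rewrite /P (proj_summand (direct_sum_blocks HXY) (i := n.+1)) ?ltnS //=.
  - by rewrite ifF //; lia.
  - by rewrite blocks_last.
  - by lia.
have [_ /(_ (n - d.+1)%N)] := HXY.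
have -> : (n - d.+1).+1 = (n - d)%N by lia.
case; [lia|move=> _ _ _ <- [u Xu [w Yw <-]] Hj].
have Hj' : (1 <= j <= n - d)%N by lia.
rewrite linD; last by apply: proj_blocks_linear; lia.
rewrite (IH w (ltnW Hd) Yw Hj') addr0.
rewrite (@proj_blocks_summand (n - d)%N) //; [|lia..].
by rewrite ifF //; lia.
Qed.

End SplittingProjections.

End DirectSums.

(** * Inverting a linear map on a complement of its kernel *)

Section PartialInverse.
Variables (K : numFieldType) (U V : lmodType K).
Variables (f : U -> V) (A : set U).
Hypotheses (Hf : linear f) (HA : is_subspace A).
Hypothesis ker0 : forall x, A x -> f x = 0 -> x = 0.
Let g := 'pinv_(cst 0) A f.

Lemma pinv_mem y : (f @` A) y -> A (g y).
Proof.
move=> Hy; have Hs : set_surj A (f @` A) f by [].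
by apply: (surjpinv_image_sub (dflt := cst 0) Hs); exists y.
Qed.

Lemma pinv_cancel y : (f @` A) y -> f (g y) = y.
Proof. by move=> Hy; apply: pinvK; apply: mem_set. Qed.

(** The pseudo-inverse of f on A is constantly 0 outside f(A), hence not linear
    on V; it becomes linear after a linear map with values in f(A). *)
Lemma linear_pinv_comp (W : lmodType K) (h : W -> V) :
  linear h -> (forall w, (f @` A) (h w)) -> linear (g \o h).
Proof.
move=> Hh hA a u v /=.
have [_ HL] := proj1 (subspaceE A) HA.
apply/eqP; rewrite -subr_eq0; apply/eqP; apply: ker0.
  by apply: subspaceB => //; [|apply: HL]; exact: pinv_mem.
by rewrite linB // Hf !pinv_cancel // Hh subrr.
Qed.

End PartialInverse.

(** * The recursion *)

Section Recursion.
Variables (K : numFieldType) (B Bbar : lmodType K).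
Variables (L : nat -> {linear B -> Bbar}) (k : nat).
Variables (Nc N : nat -> set B) (Rc R : nat -> set Bbar).
Variables (Sbar S : nat -> B -> Bbar) (E M : nat -> nat -> B -> B).
Hypothesis Hrec : recursion L k Nc N Rc R Sbar S E M.

Let linear_L i : linear (L i).
Proof. by move=> a u v; rewrite linearP. Qed.

Lemma N_S0 i x : (1 <= i <= k.+1)%N -> N i x -> S i x = 0.
Proof. by case: i => // i Hi; rewrite (rec_N Hrec) // => -[]. Qed.

(** The invariant that makes the decompositions of level j direct sums and
    their projections usable to build the operators of level j+1. *)
Definition regular j := forall i, (1 <= i <= j)%N ->
  [/\ linear (Sbar i), linear (S i), is_subspace (N i) & is_subspace (R i)].

Lemma regular_splitR j : (j <= k.+1)%N -> regular j -> splitting R Rc j.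
Proof.
move=> Hj Hreg; split=> [|i Hi]; first exact: (rec_Rc0 Hrec).
have [|HS HI Hsum] := rec_Rc Hrec (j := i); first by lia.
by have [|_ _ _ HR] := Hreg i.+1; first by lia.
Qed.

Lemma regular_splitN j : (j <= k.+1)%N -> regular j -> splitting Nc N j.
Proof.
move=> Hj Hreg; split=> [|i Hi]; first exact: (rec_N0 Hrec).
have [|HS HI Hsum] := rec_Nc Hrec (j := i); first by lia.
have [|_ _ HN _] := Hreg i.+1; first by lia.
split=> //; first by rewrite setIC.
rewrite -Hsum; apply/seteqP.
by split=> _ [u Hu [v Hv <-]]; exists v => //; exists u => //; rewrite addrC.
Qed.

Lemma regularS j : (j <= k)%N -> regular j ->
  linear (Sbar j.+1) -> linear (S j.+1) -> regular j.+1.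
Proof.
move=> Hj Hreg HSb HS i Hi.
have [->|ne] := eqVneq i j.+1; last by apply: Hreg; lia.
have HN := splitting_subspace (regular_splitN (leqW Hj) Hreg) (leqnn j).
have /subspaceE[N0 NL] := HN.
split=> //; apply/subspaceE; rewrite ?(rec_N Hrec) // ?(rec_R Hrec) //.
  split; first by split => //=; rewrite lin0.
  move=> a u v [Nu /= Su] [Nv /= Sv]; split; first exact: NL.
  by rewrite /= HS Su Sv scaler0 addr0.
split; first by exists 0 => //; rewrite lin0.
move=> a _ _ [u Nu <-] [v Nv <-]; exists (a *: u + v); first exact: NL.
by rewrite HS.
Qed.

Section Level.
Variables (j : nat).
Hypotheses (Hj : (j <= k.+1)%N) (Hreg : regular j).

Lemma S_Nc i : (1 <= i <= j)%N -> S i @` Nc i = R i.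
Proof.
case: i => // i Hi; have [|_ HS HN _] := Hreg (i := i.+1); first by lia.
rewrite (rec_R Hrec); last by lia.
have [_ /(_ i)] := regular_splitN Hj Hreg.
case; [lia|move=> HNc _ _ <-]; apply/seteqP; split=> _ [x Hx <-].
  exists x => //; exists x => //.
  by exists 0; rewrite ?addr0 //; exact: subspace0.
have [u Hu [v Hv <-]] := Hx; exists u => //.
by rewrite linD // (@N_S0 _ v) ?addr0 //; lia.
Qed.

Lemma S_Nc_ker i x : (1 <= i <= j)%N -> Nc i x -> S i x = 0 -> x = 0.
Proof.
case: i => // i Hi Ncx Sx; have HN := regular_splitN Hj Hreg.
have [_ /(_ i)[|_ _ HI _]] := HN; first by lia.
have : (Nc i.+1 `&` N i.+1) x; last by rewrite HI.
split=> //; rewrite (rec_N Hrec); last by lia.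
by split=> //; apply: (splitting_subX HN _ Ncx); lia.
Qed.

Lemma Nc_subspace i : (1 <= i <= j)%N -> is_subspace (Nc i).
Proof.
by case: i => // i Hi; have [_ /(_ i)[]] := regular_splitN Hj Hreg; first lia.
Qed.

Lemma S_R i x : (1 <= i <= j)%N -> N i.-1 x -> R i (S i x).
Proof.
by case: i => // i Hi Nx; rewrite (rec_R Hrec); [exists x|lia].
Qed.

End Level.

(** E_(j+1) inverts S_1, ..., S_j and projects with respect to the
    decomposition of level j+1, so that regularity up to j+1 is what makes it
    meaningful. *)
Section NextColumn.
Variable j : nat.
Hypotheses (Hj : (1 <= j <= k)%N) (Hreg : regular j.+1).

Let Hj1 : (j.+1 <= k.+1)%N. Proof. lia. Qed.
Let P := proj (blocks R Rc j.+1) 1 j.+3.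

Let P_R i y : (1 <= i <= j)%N -> (S i @` Nc i) (P i y).
Proof.
move=> Hi; rewrite (S_Nc Hj1 Hreg); last by lia.
rewrite -(@blocks_low _ _ R Rc j.+1); last by lia.
by apply: (proj_in (direct_sum_blocks (regular_splitR Hj1 Hreg))) => //; lia.
Qed.

Lemma E_Nc i x : (1 <= i <= j)%N -> Nc i (E i j.+1 x).
Proof.
move=> Hi; rewrite (rec_E Hrec) // opprfctE -[- _]add0r.
have HNc : is_subspace (Nc i) by apply: (Nc_subspace Hj1 Hreg); lia.
by apply: subspaceB => //; [exact: subspace0|apply: pinv_mem; exact: P_R].
Qed.

(** The defining equation of back substitution, solved for S_i E_(i,j+1). *)
Lemma S_E i x : (1 <= i <= j)%N ->
  S i (E i j.+1 x) = - P i (\sum_(i.+1 <= nu < j.+2) Sbar nu (E nu j.+1 x)).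
Proof.
move=> Hi; rewrite (rec_E Hrec) // opprfctE.
have [|_ HS _ _] := Hreg (i := i); first by lia.
rewrite linN //=; congr (- _).
rewrite pinv_cancel; last exact: P_R.
by rewrite fct_sumE.
Qed.

Lemma E_linear i : (1 <= i <= j.+1)%N -> linear (E i j.+1).
Proof.
(* The column is filled from bottom to top, so the induction is on j+1-i. *)
move=> Hi; rewrite -(subKn (proj2 (andP Hi))).
have : (j.+1 - i <= j)%N by lia.
move: (j.+1 - i)%N => d; elim/ltn_ind: d {i Hi} => -[|d] IH Hd.
  by rewrite subn0 (rec_Ediag Hrec).
have Hi : (1 <= j.+1 - d.+1 <= j)%N by lia.
set i := (j.+1 - d.+1)%N in Hi *.
have [|_ HS _ _] := Hreg (i := i); first by lia.
rewrite (rec_E Hrec) //; apply: linear_opp.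
apply: (linear_pinv_comp HS).
- by apply: (Nc_subspace Hj1 Hreg); lia.
- by move=> x; apply: (S_Nc_ker Hj1 Hreg); lia.
- apply: linear_o.
    by apply: (proj_blocks_linear (regular_splitR Hj1 Hreg)); lia.
  apply: linear_bigsum => nu; rewrite mem_index_iota => Hnu _.
  apply: linear_o; first by have [] := Hreg (i := nu); first lia.
  have := IH (j.+1 - nu)%N; rewrite subKn; [apply|]; lia.
- by move=> x; apply: P_R.
Qed.

Lemma M_linear_next :
  (forall i l, (1 <= i <= j)%N -> (1 <= l <= k.+1)%N -> linear (M l i)) ->
  forall l, (1 <= l <= k.+1)%N -> linear (M l j.+1).
Proof.
move=> HM [//|[|l]] Hl; first by rewrite (rec_M1 Hrec) //; apply: E_linear.
have [lj|jl] := leqP l.+1 j; last first.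
  by rewrite (rec_Mlow Hrec); [exact: linear_zero|lia..].
rewrite (rec_MS Hrec) //; apply: linear_bigsum => nu.
rewrite mem_index_iota => Hnu _.
by apply: linear_o; [apply: HM; lia|apply: E_linear; lia].
Qed.

End NextColumn.

(** The order of dependence within a step is Sbar_(j+1), S_(j+1), then N_(j+1)
    and R_(j+1), then the decomposition of level j+1, then the columns E_(j+1)
    and M_(j+1). *)
Lemma recursion_linear j : (j <= k)%N -> regular j.+1 /\
  forall i l, (1 <= i <= j.+1)%N -> (1 <= l <= k.+1)%N -> linear (M l i).
Proof.
elim: j => [|j IH] Hj.
  split.
    by apply: regularS => //; [move=> i; lia|..];
      rewrite ?(rec_S1 Hrec) (rec_Sbar1 Hrec).
  move=> i l Hi; have -> : i = 1%N by lia.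
  case: l => [//|[|l]] Hl; first by rewrite (rec_M11 Hrec).
  by rewrite (rec_Mlow Hrec) //; exact: linear_zero.
have [Hreg HM] := IH (ltnW Hj).
have HSb : linear (Sbar j.+2).
  rewrite (rec_SbarS Hrec) //; apply: linear_bigsum => i.
  rewrite mem_index_iota => Hi _.
  by apply: linear_o; [exact: linear_L|apply: HM; lia].
have Hreg' : regular j.+2.
  apply: regularS => //; rewrite (rec_SS Hrec) //; apply: linear_o => //.
  by apply: (proj_blocks_linear (regular_splitR _ Hreg)); lia.
split=> // i l Hi Hl; have [->|ne] := eqVneq i j.+2; last by apply: HM; lia.
exact: M_linear_next.
Qed.

Lemma recursion_regular j : (j <= k.+1)%N -> regular j.
Proof.
move=> Hj i Hi; have [Hreg _] := recursion_linear (leqnn k).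
by apply: Hreg; lia.
Qed.

Lemma M_diag j : (1 <= j <= k.+1)%N -> M j j = id.
Proof.
elim: j => [//|[|j] IH] Hj; first exact: (rec_M11 Hrec).
rewrite (rec_MS Hrec) //; last by lia.
rewrite big_nat_recr //= big_nat big1 ?add0r => [|nu Hnu].
  by rewrite IH ?(rec_Ediag Hrec) //; lia.
by rewrite (rec_Mlow Hrec) //; lia.
Qed.

Lemma M_linear i l : (1 <= i <= k.+1)%N -> (1 <= l <= k.+1)%N ->
  linear (M l i).
Proof. by move=> Hi Hl; apply: (proj2 (recursion_linear (leqnn k))). Qed.

Lemma splitR j : (j <= k.+1)%N -> splitting R Rc j.
Proof. by move=> Hj; apply: regular_splitR => //; exact: recursion_regular. Qed.

Lemma splitN j : (j <= k.+1)%N -> splitting Nc N j.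
Proof. by move=> Hj; apply: regular_splitN => //; exact: recursion_regular. Qed.

Lemma S_linear i : (1 <= i <= k.+1)%N -> linear (S i).
Proof. by move=> Hi; have [] := recursion_regular (leqnn _) Hi. Qed.

Lemma S_Rc i x : (1 <= i <= k.+1)%N -> Rc i.-1 (S i x).
Proof.
case: i => [//|[|i]] Hi; first by rewrite /= (rec_Rc0 Hrec).
rewrite (rec_SS Hrec); last by lia.
rewrite /= -(blocks_last R Rc).
by apply: (proj_in (direct_sum_blocks (splitR _))) => //; lia.
Qed.

(** S_nu drops from Sbar_nu its components in R_1, ..., R_(nu-1), which are
    invisible to the projections onto later summands, at whatever level n. *)
Lemma proj_Sbar n nu r x : (n <= k.+1)%N -> (1 <= nu <= n)%N ->
  (nu <= r <= n.+1)%N ->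
  proj (blocks R Rc n) 1 n.+2 r (Sbar nu x) =
  proj (blocks R Rc n) 1 n.+2 r (S nu x).
Proof.
move=> Hn Hnu Hr; case: nu Hnu Hr => [//|[|j]] Hnu Hr.
  by rewrite (rec_S1 Hrec).
have Hj1 : (j.+1 <= k.+1)%N by lia.
have [HR Hs] :=
  proj_decomp (direct_sum_blocks (splitR Hj1)) (v := Sbar j.+2 x) I.
rewrite -{1}Hs big_nat_recr //=.
have HP : linear (proj (blocks R Rc n) 1 n.+2 r).
  by apply: (proj_blocks_linear (splitR Hn)); lia.
rewrite (rec_SS Hrec); last by lia.
rewrite (linD _ _ HP) (lin_sum _ _ _ HP) big_nat big1 ?add0r // => l Hl.
rewrite (proj_blocks_summand (splitR Hn) (i := l)) ?ifF //; try lia.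
by rewrite -(@blocks_low _ _ R Rc j.+1); [apply: HR|]; lia.
Qed.

Section Columns.
Variable j : nat.
Hypotheses (Hj : (1 <= j <= k)%N).
Let Hj1 : (j.+1 <= k.+1)%N. Proof. lia. Qed.
Let P := proj (blocks R Rc j.+1) 1 j.+3.

Lemma proj_Sbar_E nu i x : (1 <= nu <= j)%N -> (nu < i <= j.+2)%N ->
  P i (Sbar nu (E nu j.+1 x)) = 0.
Proof.
move=> Hnu Hi; rewrite /P proj_Sbar //; try lia.
have HE : Nc nu (E nu j.+1 x) := E_Nc Hj (recursion_regular Hj1) x Hnu.
rewrite (proj_blocks_summand (splitR Hj1) (i := nu)) ?ifF //; try lia.
apply: (S_R (j := j.+1)) => //; first by lia.
by apply: (splitting_subX (splitN Hj1) _ HE); lia.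
Qed.

(** The purpose of the column E_(j+1): adding the terms Sbar_nu E_(nu,j+1),
    nu <= j, to Sbar_(j+1) removes its components in R_1, ..., R_j and leaves
    the remaining ones unchanged, as the projection in S_(j+1) does. *)
Lemma sum_Sbar_E x :
  \sum_(1 <= nu < j.+2) Sbar nu (E nu j.+1 x) = S j.+1 x.
Proof.
apply: (proj_inj (direct_sum_blocks (splitR Hj1))) => // i Hi.
have HP : linear (P i) by apply: (proj_blocks_linear (splitR Hj1)).
rewrite -/P; have [ij|ji] := leqP i j.
  (* Component in R_i, i <= j: the term nu = i cancels the terms nu > i. *)
  rewrite [RHS](proj_blocks_tail (splitR Hj1) (i := j)) //; try lia.
    rewrite (big_cat_nat (n := i)) //=; try lia.
    rewrite (big_ltn (m := i)); last by lia.
    rewrite !(linD _ _ HP) (lin_sum _ _ _ HP) big1_seq ?add0r.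
      rewrite {1}/P proj_Sbar //; try lia.
      have Hreg := recursion_regular Hj1.
      rewrite (proj_blocks_summand (splitR Hj1) (i := i)); try lia.
        by rewrite eqxx (S_E Hj Hreg) ?addNr //; lia.
      apply: (S_R (j := j.+1)) => //; first by lia.
      apply: (splitting_subX (splitN Hj1) (j := i)); first by lia.
      by apply: E_Nc => //; lia.
    move=> nu /=; rewrite mem_index_iota => Hnu.
    by apply: proj_Sbar_E; lia.
  by apply: (S_Rc (i := j.+1)); lia.
(* Components in R_(j+1) and Rc_(j+1): only the term nu = j+1 is left. *)
rewrite big_nat_recr //= (linD _ _ HP) (lin_sum _ _ _ HP).
rewrite big_nat big1 ?add0r; last first.
  by move=> nu Hnu; apply: proj_Sbar_E; lia.
by rewrite (rec_Ediag Hrec) // /P proj_Sbar //; lia.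
Qed.

End Columns.

(** Induction on j, expanding M_(j+1) = diag (I, M^(j)) E_(j+1): the inner sums
    are coefficients of L p_(nu-1) for nu <= j, applied to E_(nu+1,j+1) x. *)
Lemma coef_column j n x : (n <= j <= k)%N ->
  \sum_(0 <= i < n.+1) L i (M (j.+1 - n + i)%N j.+1 x) = S n.+1 x.
Proof.
elim/ltn_ind: j n x => -[|j] IH n x Hn.
  have -> : n = 0%N by lia.
  by rewrite big_nat1 (rec_M11 Hrec) (rec_S1 Hrec) (rec_Sbar1 Hrec).
have Hj : (1 <= j.+1 <= k)%N by lia.
pose y nu := E nu.+1 j.+2 x.
have step i l : (1 <= l <= j.+1)%N -> L i (M l.+1 j.+2 x) =
    \sum_(1 <= nu < j.+2) L i (M l nu (y nu)).
  by move=> Hl; rewrite (rec_MS Hrec) // fct_sumE linear_sum.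
have Mlow0 i l nu : (1 <= nu <= k.+1)%N -> (nu < l <= k.+1)%N ->
    L i (M l nu (y nu)) = 0.
  by move=> Hnu Hl; rewrite (rec_Mlow Hrec) // linear0.
have [nj|jn] := eqVneq n j.+1.
  (* Top coefficient: the inner sums are the Sbar_(nu+1), and the row
     M_(1,j+2) = E_(1,j+2) supplies the missing term Sbar_1 E_(1,j+2). *)
  rewrite nj big_nat_recl // subSnn addn0 (rec_M1 Hrec) //.
  rewrite -(sum_Sbar_E Hj) [RHS]big_ltn //; congr (_ + _).
    by rewrite (rec_Sbar1 Hrec).
  rewrite -[LHS](big_add1 _ _ 0 j.+2 xpredT
    (fun i => L i (M (1 + i)%N j.+2 x))).
  rewrite (eq_big_nat _ _ (F2 := fun i =>
      \sum_(1 <= nu < j.+2) L i (M i nu (y nu)))); last first.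
    by move=> i Hi; rewrite step //; lia.
  rewrite exchange_big_nat /= [RHS]big_add1 /=.
  apply: eq_big_nat => nu Hnu; rewrite (rec_SbarS Hrec); last by lia.
  rewrite fct_sumE [LHS](big_cat_nat (n := nu.+1)) //=; try lia.
  rewrite [X in _ + X]big1_seq ?addr0 // => i /=.
  by rewrite mem_index_iota => Hi; apply: Mlow0; lia.
rewrite (eq_big_nat _ _ (F2 := fun i =>
    \sum_(1 <= nu < j.+2) L i (M (j.+1 - n + i)%N nu (y nu)))); last first.
  move=> i Hi; rewrite -step; last by lia.
  by congr (L i (M _ _ _)); lia.
rewrite exchange_big_nat /= big_nat_recr //= IH; [|lia..].
(* The term nu = j+1 is S_(n+1) already; the others vanish. *)
rewrite /y (rec_Ediag Hrec) // big_nat big1 ?add0r // => nu Hnu.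
have [small|large] := ltnP nu (j.+1 - n).
  by rewrite big_nat big1 // => i Hi; apply: Mlow0; lia.
(* By triangularity the inner sum stops at i = m, and it is then the
   coefficient of eps^m in L p_(nu-1). *)
pose m := (n + nu - j.+1)%N.
rewrite (big_cat_nat (n := m.+1)) /=; [|lia..].
rewrite [X in _ + X]big1_seq ?addr0; last first.
  by move=> i /=; rewrite mem_index_iota => Hi; apply: Mlow0; lia.
have -> : nu = nu.-1.+1 by lia.
have -> : (j.+1 - n = nu.-1.+1 - m)%N by lia.
rewrite IH; [|lia..].
apply: N_S0; first by lia.
apply: (splitting_subX (splitN (leqnn _)) (j := nu.+1)); first by lia.
have -> : nu.-1.+2 = nu.+1 by lia.
by apply: E_Nc => //; [apply: recursion_regular|]; lia.
Qed.

End Recursion.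

(** * Block matrix entries *)

Section Entries.
Variables (K : numFieldType) (B Bbar : lmodType K).
Variables (L : nat -> {linear B -> Bbar}) (k : nat).
Variables (Nc N : nat -> set B) (Rc R : nat -> set Bbar).
Variables (Sbar S : nat -> B -> Bbar) (E M : nat -> nat -> B -> B).
Hypothesis Hrec : recursion L k Nc N Rc R Sbar S E M.

Let cols := blocks Nc N k.+1.
Let rows := blocks R Rc k.+1.
Let entry := block cols rows k.+2.

Let HR : splitting R Rc k.+1 := splitR Hrec (leqnn _).
Let HN : splitting Nc N k.+1 := splitN Hrec (leqnn _).

Lemma restr_eq (A : set B) (T T' : B -> Bbar) :
  (forall x, A x -> T x = T' x) -> restr A T = restr A T'.
Proof.
move=> H; apply/funext => x; rewrite /restr /patch.
by case: ifP => // /set_mem; exact: H.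
Qed.

Lemma restr0 (A : set B) : restr A (0 : B -> Bbar) = 0.
Proof. by apply/funext => x; rewrite /restr /patch; case: ifP. Qed.

Lemma entry_eq0 r c (T : B -> Bbar) :
  (forall x, cols c x -> proj rows 1 k.+3 r (T x) = 0) -> entry r c T = 0.
Proof. by move=> H; rewrite -(restr0 (cols c)); apply: restr_eq. Qed.

Lemma entry_zero r c : (1 <= r <= k.+2)%N -> entry r c 0 = 0.
Proof.
move=> Hr; apply: entry_eq0 => x _.
by apply: lin0; exact: (proj_blocks_linear HR).
Qed.

Lemma S_after i c x : (1 <= i <= k.+1)%N -> (i < c <= k.+2)%N -> cols c x ->
  S i x = 0.
Proof.
move=> Hi Hc Hx; apply: (N_S0 Hrec) => //; move: Hx.
rewrite /cols /blocks; case: leqP => ck.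
  by apply: (splitting_subX HN); lia.
by apply: (splitting_sub HN); lia.
Qed.

Lemma entry_above i r c : (1 <= i <= k.+1)%N -> (1 <= r < i)%N ->
  entry r c (S i) = 0.
Proof.
move=> Hi Hr; apply: entry_eq0 => x _.
by apply: (proj_blocks_tail HR (S_Rc Hrec x Hi)); lia.
Qed.

Lemma entry_after i r c : (1 <= i <= k.+1)%N -> (1 <= r <= k.+2)%N ->
  (i < c <= k.+2)%N -> entry r c (S i) = 0.
Proof.
move=> Hi Hr Hc; apply: entry_eq0 => x Hx.
rewrite (S_after Hi Hc Hx).
by apply: lin0; exact: (proj_blocks_linear HR).
Qed.

Lemma proj_S_Nc i r x : (1 <= i <= k.+1)%N -> (1 <= r <= k.+2)%N -> cols i x ->
  proj rows 1 k.+3 r (S i x) = if r == i then S i x else 0.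
Proof.
move=> Hi Hr; rewrite /cols blocks_low; last by lia.
move=> Hx; apply: (proj_blocks_summand HR) => //.
apply: (S_R Hrec (leqnn _) Hi).
by apply: (splitting_subX HN _ Hx); lia.
Qed.

Lemma entry_pivot_col i r : (1 <= i <= k.+1)%N -> (1 <= r <= k.+2)%N ->
  r != i -> entry r i (S i) = 0.
Proof.
move=> Hi Hr /negPf ri; apply: entry_eq0 => x Hx.
by rewrite proj_S_Nc // ri.
Qed.

Lemma entry_pivot i : (1 <= i <= k.+1)%N ->
  entry i i (S i) = restr (Nc i) (S i).
Proof.
move=> Hi; have <- : cols i = Nc i by rewrite /cols blocks_low //; lia.
by apply: restr_eq => x Hx; rewrite /= proj_S_Nc ?eqxx //; lia.
Qed.

Lemma S_image_Nc0 i : (1 <= i <= k.+1)%N -> S i @` N i = [set 0].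
Proof.
move=> Hi; apply/seteqP; split=> [_ [x Nx <-]|_ ->].
  by rewrite (N_S0 Hrec Hi Nx).
exists 0; first by apply: subspace0; apply: (splitting_subspace HN); lia.
by apply: lin0; exact: (S_linear Hrec).
Qed.

End Entries.

Theorem theorem1 (K : numFieldType) (B Bbar : lmodType K)
    (L : nat -> {linear B -> Bbar}) (k : nat)
    (Nc N : nat -> set B) (Rc R : nat -> set Bbar)
    (Sbar S : nat -> B -> Bbar) (E M : nat -> nat -> B -> B)
    (Hrec : recursion L k Nc N Rc R Sbar S E M) :
  let cols := blocks Nc N k.+1 in
  let rows := blocks R Rc k.+1 in
  let p := op_poly k (fun n => M (k.+1 - n)%N k.+1) in
  let P := op_poly k (fun n => S n.+1) in
  let entry := block cols rows k.+2 in
  let entry_series := block_series cols rows k.+2 in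
  (* the associated direct sums *)
  (direct_sum cols 1 k.+3 setT /\ direct_sum rows 1 k.+3 setT) /\
  (* p_k is an operator polynomial with constant coefficient I_B *)
  (p 0%N = id /\ forall n, linear (p n)) /\
  (* L(eps) p_k(eps) = S_1 + ... + eps^k S_(k+1) + O(eps^(k+1)) *)
  (exists Q : nat -> {linear B -> Bbar},
     cauchy_product L p =
       (fun n => if (n <= k)%N then S n.+1 else Q n.+1)) /\
  (* the leading coefficients *)
  (forall i, (1 <= i <= k.+1)%N ->
     [/\ linear (S i),
         S i @` sum_of Nc 0 i `<=` Rc i.-1,
         S i @` Nc i = R i
       & S i @` N i = [set 0]]) /\
  (* the block matrix of S_i *)
  (forall i, (1 <= i <= k.+1)%N ->
     [/\ forall r c, (1 <= c < i)%N -> (1 <= r < i)%N -> entry r c (S i) = 0,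
         forall r, (1 <= r <= k.+2)%N -> r != i -> entry r i (S i) = 0
       & forall r c, (1 <= r <= k.+2)%N -> (i < c <= k.+2)%N ->
           entry r c (S i) = 0]) /\
  (* the block matrix of P_k(eps) *)
  [/\ forall i, (1 <= i <= k.+1)%N ->
        entry_series i i P = op_monomial i.-1 (restr (Nc i) (S i)),
      forall r c, (1 <= r < c)%N -> (c <= k.+2)%N ->
        entry_series r c P = fun=> 0,
      forall r, (1 <= r <= k.+2)%N -> entry_series r k.+2 P = fun=> 0
    & entry_series k.+2 k.+1 P = fun=> 0].
Proof.
move=> cols rows p P entry entry_series.
have HR := splitR Hrec (leqnn _); have HN := splitN Hrec (leqnn _).
have p_linear n : linear (p n).
  rewrite /p /op_poly; case: leqP => Hn; last exact: linear_zero.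
  by apply: (M_linear Hrec); lia.
have coefL n : linear (cauchy_product L p n).
  apply: linear_bigsum => i _ _; apply: linear_o => // a u v.
  exact: linearP.
have P_low n : (n <= k)%N -> P n = S n.+1 by rewrite /P /op_poly => ->.
have P_high n : (k < n)%N -> P n = 0.
  by move=> kn; rewrite /P /op_poly ifF //; lia.
have series_eq r c F : (1 <= r <= k.+2)%N ->
    (forall n, (n <= k)%N -> entry r c (S n.+1) = F n) ->
    (forall n, (k < n)%N -> F n = 0) -> entry_series r c P = F.
  move=> Hr Hlow Hhigh; apply/funext => n; rewrite /entry_series /block_series.
  have [nk|kn] := leqP n k; first by rewrite P_low //; exact: Hlow.
  by rewrite P_high // Hhigh //; exact: (entry_zero Hrec).
split; first by split; exact: direct_sum_blocks.
split.
  split=> //; rewrite /p /op_poly /= subn0.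
  by apply: (M_diag Hrec); lia.
split.
  exists (fun n => linear_map (coefL n.-1)); apply/funext => n.
  case: leqP => // nk; apply/funext => x.
  rewrite -(coef_column Hrec (j := k)) ?nk ?leqnn //.
  rewrite /cauchy_product fct_sumE big_mkord; apply: eq_bigr => i _ /=.
  rewrite /p /op_poly ifT; last by lia.
  by congr (L i (M _ _ x)); have := ltn_ord i; lia.
split.
  move=> i Hi; split.
  - exact: (S_linear Hrec).
  - by move=> _ [x _ <-]; exact: (S_Rc Hrec).
  - exact: (S_Nc Hrec (leqnn _) (recursion_regular Hrec (leqnn _))).
  - exact: (S_image_Nc0 Hrec).
split.
  move=> i Hi; split.
  - by move=> r c _ Hr; exact: (entry_above Hrec).
  - by move=> r Hr ri; exact: (entry_pivot_col Hrec).
  - by move=> r c Hr Hc; exact: (entry_after Hrec).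
split.
- move=> i Hi; apply: series_eq; first by lia.
    move=> n nk; rewrite /op_monomial.
    have [ni|ni|ni] := ltngtP n i.-1.
    + by apply: (entry_after Hrec); lia.
    + by apply: (entry_above Hrec); lia.
    + have -> : n.+1 = i by lia.
      exact: (entry_pivot Hrec).
  by move=> n kn; rewrite /op_monomial ifF //; lia.
- move=> r c Hr Hc; apply: series_eq => //; first by lia.
  move=> n nk; have [nc|cn] := ltnP n.+1 c.
    by apply: (entry_after Hrec); lia.
  by apply: (entry_above Hrec); lia.
- move=> r Hr; apply: series_eq => // n nk.
  by apply: (entry_after Hrec); lia.
- apply: series_eq => // [|n nk]; first by lia.
  have [->|ne] := eqVneq n k; first by apply: (entry_pivot_col Hrec); lia.
  by apply: (entry_after Hrec); lia.
Qed.
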